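(* Let $D\in\mathbb{R}^{n\times n}$ and suppose that the largest eigenvalue $\nu$ of $\mathcal{A}^\dagger(D)$ has multiplicity $1$. Let $\mu$ be a unit-norm eigenvector of $\mathcal{A}^\dagger(D)$ corresponding to $\nu$. Then the optimization $$\max_{Z\in\mathbb{S}^{2^{n-1}},\ Z\succeq0,\ \mathrm{trace}(Z)=1}\ \langle\mathcal{A}^\dagger(D),Z\rangle$$ has a unique optimal solution $Z^*$, given by $Z^*=\mu\mu^\top$.
   Context: $\langle A,B\rangle=\mathrm{trace}(A^\top B)$, and $\mathbb{S}^m$ is the space of real symmetric $m\times m$ matrices. Put $I_2=\begin{bmatrix}1&0\\0&1\end{bmatrix}$, $\sigma=\begin{bmatrix}1&0\\0&-1\end{bmatrix}$, $J=\begin{bmatrix}0&-1\\1&0\end{bmatrix}$. For $1\le i\le n$ define the $2^n\times2^n$ matrices $$\lambda_i=\sigma^{\otimes(i-1)}\otimes J\otimes I_2^{\otimes(n-i)},\qquad \rho_i=I_2^{\otimes(i-1)}\otimes J\otimes\sigma^{\otimes(n-i)},$$ and the $2^n\times 2^{n-1}$ matrix $$P_{\mathrm{even}}=\frac12\begin{bmatrix}I+\sigma^{\otimes(n-1)}\\ I-\sigma^{\otimes(n-1)}\end{bmatrix},$$ with $I$ the identity of size $2^{n-1}$. Let $A_{ij}=-P_{\mathrm{even}}^\top\lambda_i\rho_jP_{\mathrm{even}}\in\mathbb{S}^{2^{n-1}}$, and define $\mathcal{A}^\dagger:\mathbb{R}^{n\times n}\to\mathbb{S}^{2^{n-1}}$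 by $\mathcal{A}^\dagger(Y)=\sum_{i,j}A_{ij}Y_{ij}$ (this is the adjoint of the map $\mathcal{A}(Z)=(\langle A_{ij},Z\rangle)_{i,j}$). *)

(* Defs.v *)
From HB Require Import structures.
From mathcomp Require Import all_boot all_order all_algebra.
From mathcomp Require Import reals.
From mathcomp.real_closed Require Import mxtens.

Set Implicit Arguments.
Unset Strict Implicit.
Unset Printing Implicit Defensive.

Import Order.TTheory GRing.Theory Num.Theory.
Local Open Scope ring_scope.

(* Matrix sizes are n.+1, 2 ^ n.+1 and 2 ^ n, i.e. the dimension is n.+1 >= 1,
   and indices i : 'I_n.+1 are 0-based: i factors stand to the left of J and
   n - i factors to its right.  The Kronecker product *t and power ^t of mxtens
   are the usual ones: the left factor gives the outer block structure, and
   A ^t 0 is the 1 x 1 identity. *)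

Section Clifford.
Variable R : realType.

Definition I2 : 'M[R]_2 := 1%:M.
Definition sigma : 'M[R]_2 := @block_mx _ 1 1 1 1 1 0 0 (- 1).
Definition J : 'M[R]_2 := @block_mx _ 1 1 1 1 0 (- 1) 1 0.

Lemma dim_tens n (i : 'I_n.+1) : (2 ^ i * 2 * 2 ^ (n - i) = 2 ^ n.+1)%N.
Proof. by rewrite -expnSr -expnD addSn subnKC // -ltnS. Qed.

Lemma dim_col n : (2 ^ n + 2 ^ n = 2 ^ n.+1)%N.
Proof. by rewrite addnn -mul2n expnS. Qed.

(* The casts only identify propositionally equal dimensions. *)
Definition lambda n (i : 'I_n.+1) : 'M[R]_(2 ^ n.+1) :=
  castmx (dim_tens i, dim_tens i) (sigma ^t i *t J *t I2 ^t (n - i)).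

Definition rho n (i : 'I_n.+1) : 'M[R]_(2 ^ n.+1) :=
  castmx (dim_tens i, dim_tens i) (I2 ^t i *t J *t sigma ^t (n - i)).

Definition Peven n : 'M[R]_(2 ^ n.+1, 2 ^ n) :=
  castmx (dim_col n, erefl (2 ^ n)%N)
    (2^-1 *: col_mx (1%:M + sigma ^t n) (1%:M - sigma ^t n)).

Definition Amx n (i j : 'I_n.+1) : 'M[R]_(2 ^ n) :=
  - ((Peven n)^T *m lambda i *m rho j *m Peven n).

Definition Adagger n (Y : 'M[R]_n.+1) : 'M[R]_(2 ^ n) :=
  \sum_(i < n.+1) \sum_(j < n.+1) Y i j *: Amx i j.

End Clifford.

Section Optimization.
Variable R : realType.

Definition mxinner m p (A B : 'M[R]_(m, p)) : R := \tr (A^T *m B).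

(* Euclidean norm, as opposed to the sup norm that MathComp-Analysis puts on
   matrices. *)
Definition norm2 m (v : 'cV[R]_m) : R := Num.sqrt (mxinner v v).

Definition psdmx m (Z : 'M[R]_m) : Prop :=
  forall x : 'cV[R]_m, 0 <= (x^T *m Z *m x) 0 0.

Definition is_largest_eigenvalue m (M : 'M[R]_m) (nu : R) : Prop :=
  eigenvalue M nu /\ forall a : R, eigenvalue M a -> a <= nu.

(* Multiplicity as a root of the characteristic polynomial; for symmetric M it
   equals the dimension of the eigenspace. *)
Definition eigen_multiplicity m (M : 'M[R]_m) (a : R) : nat :=
  mup a (char_poly M).

Definition feasible m (Z : 'M[R]_m) : Prop :=
  [/\ Z \is symmetricmx, psdmx Z & \tr Z = 1].

Definition optimal_solution m (C Z : 'M[R]_m) : Prop :=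
  feasible Z /\ forall W : 'M[R]_m, feasible W -> mxinner C W <= mxinner C Z.

End Optimization.

(* Main.v *)
Require Import Defs.
From mathcomp Require Import all_boot all_order all_algebra.
From mathcomp Require Import reals.
From mathcomp Require Import complex mxtens ring.

(** Every lambda_i commutes with every rho_j and both are skew-symmetric, so
    Adagger D is symmetric.  For a real symmetric M, diagonalise M = P^* d P
    over R[i] with P unitary and d real, and put W = P Z P^*: for feasible Z the
    diagonal of W is nonnegative with sum 1, and <M, Z> = \sum_i d_i W_ii, which
    is at most nu.  Equality forces W_ii = 0 unless i is the unique k with
    d_k = nu; since W is positive semidefinite its other rows and columns vanish
    too, so W = E_kk and Z = P^* E_kk P is determined.  As mu mu^T is feasible
    and attains nu, it is this Z. *)

Set Implicit Arguments.
Unset Strict Implicit.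
Unset Printing Implicit Defensive.

Import Order.TTheory GRing.Theory Num.Theory.
Local Open Scope ring_scope.

(** * Kronecker products, dimension casts and splitting off the first factor *)

Section TensorCast.
Variable R : comNzRingType.

Lemma castmx_tensl m m' n n' p q (em : m = m') (en : n = n')
    (A : 'M[R]_(m, n)) (B : 'M[R]_(p, q)) :
  castmx (em, en) A *t B =
  castmx (congr1 (muln^~ p) em, congr1 (muln^~ q) en) (A *t B).
Proof. by subst; rewrite !castmx_id. Qed.

Lemma castmx_tensr m n p p' q q' (ep : p = p') (eq : q = q')
    (A : 'M[R]_(m, n)) (B : 'M[R]_(p, q)) :
  A *t castmx (ep, eq) B =
  castmx (congr1 (muln m) ep, congr1 (muln n) eq) (A *t B).
Proof. by subst; rewrite !castmx_id. Qed.

Lemma tensmxA m n p q r s (A : 'M[R]_(m, n)) (B : 'M[R]_(p, q))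
    (C : 'M[R]_(r, s)) :
  A *t (B *t C) = castmx (esym (mulnA m p r), esym (mulnA n q s)) (A *t B *t C).
Proof.
apply/matrixP=> i j.
case: (mxtens_indexP i)=> i0 i'; case: (mxtens_indexP i')=> i1 i2 {i i'}.
case: (mxtens_indexP j)=> j0 j'; case: (mxtens_indexP j')=> j1 j2 {j j'}.
rewrite castmxE !tensmxE mulrA -!tensmxE.
(* Both nested indices flatten to i0 p r + i1 r + i2. *)
by congr (_ _ _); apply: val_inj => /=; rewrite mulnDl addnA mulnA.
Qed.

Lemma tensNmx m n p q (A : 'M[R]_(m, n)) (B : 'M[R]_(p, q)) :
  (- A) *t B = - (A *t B).
Proof. by apply/matrixP=> i j; rewrite !mxE mulNr. Qed.

Lemma tensmxN m n p q (A : 'M[R]_(m, n)) (B : 'M[R]_(p, q)) :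
  A *t (- B) = - (A *t B).
Proof. by apply/matrixP=> i j; rewrite !mxE mulrN. Qed.

Lemma castmxN m n m' n' (e : (m = m') * (n = n')) (A : 'M[R]_(m, n)) :
  castmx e (- A) = - castmx e A.
Proof. by case: e => e1 e2; subst; rewrite !castmx_id. Qed.

Lemma tens1mx1 m n : 1%:M *t 1%:M = 1%:M :> 'M[R]_(m * n).
Proof.
apply/matrixP=> i j; rewrite !mxE -natrM mulnb -(can_eq (@mxtens_unindexK m n)).
by rewrite -xpair_eqE.
Qed.

(** Keeps the dimension in the form [2 ^ n.+1], so that inductions over tensor factors meet no
    casts. *)
Definition tcons n (A : 'M[R]_2) (B : 'M[R]_(2 ^ n)) : 'M[R]_(2 ^ n.+1) :=
  castmx (esym (expnS 2 n), esym (expnS 2 n)) (A *t B).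

Lemma mul_tcons n (A C : 'M[R]_2) (B D : 'M[R]_(2 ^ n)) :
  tcons A B *m tcons C D = tcons (A *m C) (B *m D).
Proof.
by rewrite /tcons -tensmx_mul; case: _ / (esym (expnS 2 n)); rewrite !castmx_id.
Qed.

Lemma tr_tcons n (A : 'M[R]_2) (B : 'M[R]_(2 ^ n)) :
  (tcons A B)^T = tcons A^T B^T.
Proof. by rewrite /tcons trmx_cast trmx_tens. Qed.

Lemma tconsNl n (A : 'M[R]_2) (B : 'M[R]_(2 ^ n)) :
  tcons (- A) B = - tcons A B.
Proof. by rewrite /tcons tensNmx castmxN. Qed.

Lemma tconsNr n (A : 'M[R]_2) (B : 'M[R]_(2 ^ n)) :
  tcons A (- B) = - tcons A B.
Proof. by rewrite /tcons tensmxN castmxN. Qed.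

Lemma ntensmxS_tcons n (A : 'M[R]_2) : A ^t n.+1 = tcons A (A ^t n).
Proof.
case: n => [|n]; last by rewrite ntensmxSS /tcons castmx_id.
by rewrite ntensmx0 ntensmx1 /tcons tens_mx_scalar scale1r castmx_comp castmx_id.
Qed.

(* [lambda R] is convertible to [slot sigma J I2] and [rho R] to
   [slot I2 J sigma]. *)
Definition slot (A K B : 'M[R]_2) n (i : 'I_n.+1) : 'M[R]_(2 ^ n.+1) :=
  castmx (dim_tens i, dim_tens i) (A ^t i *t K *t B ^t (n - i)).

Lemma slot0 A K B n : slot A K B (ord0 : 'I_n.+1) = tcons K (B ^t n).
Proof.
(* [n - 0] occurs in types, so it is generalised before being replaced by [n]. *)
rewrite /slot; move: (dim_tens _) => /=; move: (subn0 n).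
move: (n - 0)%N => b -> e; rewrite ntensmx0 tens_scalar1mx castmx_tensl.
rewrite castmx_comp; congr castmx; congr pair; exact: nat_irrelevance.
Qed.

Lemma slotS A K B n (i : 'I_n.+1) :
  slot A K B (lift ord0 i) = tcons A (slot A K B i).
Proof.
(* [n.+1 - i.+1] is convertible to [n - i]; an arbitrary [e] detaches the claim from one particular
   cast proof. *)
suff E (e : (2 ^ i.+1 * 2 * 2 ^ (n - i) = 2 ^ n.+2)%N) :
    castmx (e, e) (A ^t i.+1 *t K *t B ^t (n - i)) = tcons A (slot A K B i).
  exact: E.
rewrite /slot ntensmxS_tcons /tcons.
rewrite !(castmx_tensl, castmx_tensr, tensmxA, castmx_comp).
congr castmx; congr pair; exact: nat_irrelevance.
Qed.

End TensorCast.

(** * Commutation relations and symmetry of [Adagger] *)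

Section Clifford.
Variable R : realType.
Local Notation s := (sigma R).
Local Notation K := (J R).

Lemma tr_sigma : s^T = s.
Proof. by rewrite /sigma (@tr_block_mx R 1 1 1 1) raddfN /= !trmx0 trmx1. Qed.

Lemma tr_J : K^T = - K.
Proof.
rewrite /J (@tr_block_mx R 1 1 1 1) (@opp_block_mx R 1 1 1 1).
by rewrite raddfN /= !trmx0 trmx1 !oppr0 opprK.
Qed.

Lemma mul_J_sigma : K *m s = - (s *m K).
Proof.
rewrite /J /sigma !(@mulmx_block R 1 1 1 1 1 1) (@opp_block_mx R 1 1 1 1).
rewrite !(mul0mx, mulmx0, mulNmx, mulmxN, mul1mx, mulmx1).
by rewrite !(addr0, add0r, oppr0, opprK).
Qed.

Lemma tr_ntens n (A : 'M[R]_2) : (A ^t n)^T = A^T ^t n.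
Proof.
elim: n => [|n IHn]; first by rewrite !ntensmx0 trmx1.
by rewrite !ntensmxS_tcons tr_tcons IHn.
Qed.

Lemma ntens_I2 n : I2 R ^t n = 1%:M.
Proof.
elim: n => [|n IHn]; first by rewrite ntensmx0.
rewrite ntensmxS_tcons IHn /tcons tens1mx1.
by case: _ / (esym (expnS 2 n)); rewrite castmx_id.
Qed.

Lemma lambda0 n : lambda R (ord0 : 'I_n.+1) = tcons K 1%:M.
Proof. by rewrite [LHS]slot0 ntens_I2. Qed.

Lemma lambdaS n (i : 'I_n.+1) : lambda R (lift ord0 i) = tcons s (lambda R i).
Proof. exact: slotS. Qed.

Lemma rho0 n : rho R (ord0 : 'I_n.+1) = tcons K (s ^t n).
Proof. exact: slot0. Qed.

Lemma rhoS n (i : 'I_n.+1) : rho R (lift ord0 i) = tcons 1%:M (rho R i).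
Proof. exact: slotS. Qed.

Lemma tr_slot (A L B : 'M[R]_2) n (i : 'I_n.+1) :
  (slot A L B i)^T = slot A^T L^T B^T i.
Proof. by rewrite /slot trmx_cast /= !trmx_tens !tr_ntens. Qed.

Lemma slotN (A L B : 'M[R]_2) n (i : 'I_n.+1) :
  slot A (- L) B i = - slot A L B i.
Proof. by rewrite /slot -castmxN tensmxN tensNmx. Qed.

Lemma tr_lambda n (i : 'I_n.+1) : (lambda R i)^T = - lambda R i.
Proof. by rewrite [LHS]tr_slot trmx1 [s^T]tr_sigma [K^T]tr_J slotN. Qed.

Lemma tr_rho n (i : 'I_n.+1) : (rho R i)^T = - rho R i.
Proof. by rewrite [LHS]tr_slot trmx1 [s^T]tr_sigma [K^T]tr_J slotN. Qed.

Lemma ord_lift n (P : 'I_n.+1 -> Prop) :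
  P ord0 -> (forall i, P (lift ord0 i)) -> forall i, P i.
Proof. by move=> P0 PS i; case: (unliftP ord0 i) => [j|] ->. Qed.

(** Exactly one factor of [lambda R i] is [J], which anticommutes with [sigma]; the other factors
    commute with it. *)
Lemma lambda_sigma n (i : 'I_n.+1) :
  lambda R i *m s ^t n.+1 = - (s ^t n.+1 *m lambda R i).
Proof.
elim: n i => [|n IHn]; apply: ord_lift => [|i]; rewrite ?lambda0 ?lambdaS.
- by rewrite ntensmxS_tcons !mul_tcons mul_J_sigma tconsNl ?mulmx1 ?mul1mx.
- by case: i.
- by rewrite ntensmxS_tcons !mul_tcons mul_J_sigma tconsNl ?mulmx1 ?mul1mx.
- by rewrite (ntensmxS_tcons n.+1) !mul_tcons IHn tconsNr.
Qed.

Lemma lambda_rhoC n (i j : 'I_n.+1) :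
  lambda R i *m rho R j = rho R j *m lambda R i.
Proof.
elim: n i j => [|n IHn]; apply: ord_lift => [|i]; apply: ord_lift => [|j];
  rewrite ?lambda0 ?lambdaS ?rho0 ?rhoS;
  try by [case: i|case: j|rewrite !mul_tcons ?mulmx1 ?mul1mx].
(* Here i > 0 and j = 0: the first factor and the remaining ones each contribute a sign, and the two
   cancel. *)
- by rewrite !mul_tcons mul_J_sigma lambda_sigma tconsNl tconsNr.
- by rewrite !mul_tcons IHn mulmx1 mul1mx.
Qed.

Lemma tr_Amx n (i j : 'I_n.+1) : (Amx R i j)^T = Amx R i j.
Proof.
rewrite /Amx linearN /= !trmx_mul trmxK tr_lambda tr_rho.
rewrite !(mulNmx, mulmxN) !opprK !mulmxA.
by rewrite -[in RHS](mulmxA _ (lambda R i)) lambda_rhoC !mulmxA.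
Qed.

Lemma tr_Adagger n (Y : 'M[R]_n.+1) : (Adagger Y)^T = Adagger Y.
Proof.
rewrite /Adagger linear_sum; apply: eq_bigr => i _.
by rewrite linear_sum; apply: eq_bigr => j _; rewrite linearZ /= tr_Amx.
Qed.

End Clifford.

(** * Characteristic polynomials, simple roots and expansion of bilinear forms *)

Lemma char_poly_conj (F : fieldType) n (P B : 'M[F]_n) : P \in unitmx ->
  char_poly (invmx P *m B *m P) = char_poly B.
Proof.
move=> uP; have PV : map_mx polyC (invmx P) *m map_mx polyC P = 1%:M.
  by rewrite -map_mxM mulVmx // map_mx1.
rewrite /char_poly.
(* ['X] is scalar, so the whole characteristic matrix is conjugated by P. *)
have -> : char_poly_mx (invmx P *m B *m P) =
    map_mx polyC (invmx P) *m char_poly_mx B *m map_mx polyC P.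
  rewrite /char_poly_mx !map_mxM mulmxBr mulmxBl scalar_mxC.
  by rewrite -(mulmxA 'X%:M) PV mulmx1.
by rewrite !det_mulmx mulrAC -det_mulmx PV det1 mul1r.
Qed.

(** The multiplicity counts the indices i with e i = a; if it is 1, they form a singleton. *)
Lemma simple_root_prod (K : fieldType) (I : finType) (e : I -> K) (a : K) :
  mup a (\prod_i ('X - (e i)%:P)) = 1%N ->
  exists2 k, e k = a & forall i, i != k -> e i != a.
Proof.
rewrite -(big_map e xpredT (fun y => 'X - y%:P)) mu_prod_XsubC count_map.
rewrite -sum1_count sum1_card => /mem_card1[k ek].
have {}ek i : (e i == a) = (i == k) by have := ek i; rewrite !inE.
by exists k => [|i]; [apply/eqP; rewrite ek | rewrite ek].
Qed.

(** [p] and [q] are independent so that conjugation can make them -i and i when complex vectors are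
    split. *)
Lemma bilin_entry (K : comNzRingType) m (Z : 'M[K]_m) (a w : 'rV[K]_m)
    (b v : 'cV[K]_m) (p q : K) :
  ((a + p *: w) *m Z *m (b + q *: v)) 0 0 =
  (a *m Z *m b) 0 0 + q * (a *m Z *m v) 0 0
  + (p * (w *m Z *m b) 0 0 + p * q * (w *m Z *m v) 0 0).
Proof.
have entryD (X Y : 'M[K]_1) : (X + Y) 0 0 = X 0 0 + Y 0 0 by rewrite mxE.
have entryZ k (X : 'M[K]_1) : (k *: X) 0 0 = k * X 0 0 by rewrite mxE.
rewrite !mulmxDl !mulmxDr -!(scalemxAl, scalemxAr) !(entryD, entryZ).
by rewrite !mulrA.
Qed.

(** * Isotropic vectors of a positive semidefinite real matrix *)

Section Psd.
Variables (R : realType) (m : nat) (Z : 'M[R]_m).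
Hypotheses (Zsym : Z^T = Z) (Zpsd : psdmx Z).

Lemma sym_form (x y : 'cV[R]_m) : (x^T *m Z *m y) 0 0 = (y^T *m Z *m x) 0 0.
Proof.
have -> : x^T *m Z *m y = (y^T *m Z *m x)^T; last by rewrite mxE.
by rewrite !trmx_mul trmxK Zsym mulmxA.
Qed.

Lemma psd_isotropic (a : 'cV[R]_m) : (a^T *m Z *m a) 0 0 = 0 -> Z *m a = 0.
Proof.
(* Test Z at a - u w for w = Z a and u = |w|^2 / (w^T Z w + 1). *)
move=> a0; set w := Z *m a.
have c0 := Zpsd w; set c := (w^T *m Z *m w) 0 0 in c0.
pose s := (w^T *m w) 0 0.
have sE : s = \sum_i w i 0 ^+ 2.
  by rewrite /s mxE; apply: eq_bigr => i _; rewrite mxE expr2.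
have wa : (w^T *m Z *m a) 0 0 = s by rewrite -mulmxA.
have c1 : c + 1 != 0 by rewrite gt_eqF // ltr_wpDl.
pose u := s / (c + 1); have su : s = u * (c + 1) by rewrite /u divfK.
have := Zpsd (a - u *: w).
rewrite -scaleNr [(_ + _)^T]linearD /= [(_ *: _)^T]linearZ /= bilin_entry.
rewrite a0 (sym_form a w) wa -/c su => h.
(* As s = u (c + 1), the form at the test vector is - u^2 (c + 2), where c >= 0; its nonnegativity
   forces u = 0, hence s = |w|^2 = 0. *)
have u0 : u = 0.
  apply/eqP; rewrite -sqrf_eq0 eq_le sqr_ge0 andbT.
  rewrite -(pmulr_lle0 _ (_ : 0 < c + 2)) ?ltr_wpDl // -oppr_ge0.
  by apply: le_trans h _; rewrite le_eqVlt; apply/orP; left; apply/eqP; ring.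
apply/matrixP => i j; rewrite ord1 [RHS]mxE; apply/eqP; rewrite -sqrf_eq0.
have /eqP := su; rewrite u0 mul0r sE psumr_eq0 => [/allP/(_ i)|k _].
  by rewrite mem_index_enum; exact.
exact: sqr_ge0.
Qed.

End Psd.

(** * Extension of the form to complex vectors *)

Section Complexify.
Variables (R : realType) (m : nat) (Z : 'M[R]_m).
Hypotheses (Zsym : Z^T = Z) (Zpsd : psdmx Z).
Local Notation f := (real_complex R).
Local Notation C := (R[i])%C.
Local Open Scope sesquilinear_scope.

Lemma map_mx_ReIm (y : 'cV[C]_m) :
  y = map_mx f (map_mx (@complex.Re R) y) +
      'i%C *: map_mx f (map_mx (@complex.Im R) y).
Proof. by apply/matrixP => i j; rewrite !mxE [LHS]complexE. Qed.

(** The cross terms carry i and -i and cancel by symmetry of [Z]. *)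
Lemma complex_form (y : 'cV[C]_m)
    (a := map_mx (@complex.Re R) y) (b := map_mx (@complex.Im R) y) :
  (y^t* *m map_mx f Z *m y) 0 0 =
  f ((a^T *m Z *m a) 0 0 + (b^T *m Z *m b) 0 0).
Proof.
have ytE : y^t* = map_mx f a^T - 'i%C *: map_mx f b^T.
  apply/matrixP => i j; rewrite !mxE; case: (y j i) => p q /=.
  by simpc; reflexivity.
have entryf (X : 'M[R]_1) : (map_mx f X) 0 0 = f (X 0 0) by rewrite mxE.
rewrite ytE -scaleNr {1}(map_mx_ReIm y) bilin_entry.
rewrite -!map_mxM !entryf (sym_form Zsym b a).
by rewrite !mulNr -expr2 sqr_i mulN1r opprK -addrA addNKr rmorphD.
Qed.

(** Needed for the rows of the unitary matrix, which are complex. Two nonnegative reals with sum 0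
    vanish, so the real and imaginary parts are both isotropic. *)
Lemma complex_psd_isotropic (y : 'cV[C]_m) :
  (y^t* *m map_mx f Z *m y) 0 0 = 0 -> map_mx f Z *m y = 0.
Proof.
rewrite complex_form => /complexI/eqP; rewrite paddr_eq0 ?Zpsd //.
case/andP => /eqP/(psd_isotropic Zsym Zpsd) Za /eqP/(psd_isotropic Zsym Zpsd) Zb.
rewrite [in LHS](map_mx_ReIm y) mulmxDr -scalemxAr -!map_mxM.
by rewrite Za Zb !map_mx0 scaler0 addr0.
Qed.

End Complexify.

(** * Spectral decomposition, diagonal weights and maximisers *)

Section Spectral.
Variables (R : realType) (m : nat).
Local Notation f := (real_complex R).
Local Notation C := (R[i])%C.
Local Open Scope sesquilinear_scope.

(** The Hermitian spectral theorem over [R[i]], with real spectrum. The characteristic polynomial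
    carries eigenvalues and multiplicities of [M] over to the indices of [e]. *)
Lemma real_sym_spectral (M : 'M[R]_m) : M^T = M ->
  exists (P : 'M[C]_m) (e : 'I_m -> R),
  [/\ P \is unitarymx, map_mx f M = P^t* *m diag_mx (\row_i f (e i)) *m P
    & char_poly M = \prod_i ('X - (e i)%:P)].
Proof.
move=> Msym; set M' := map_mx f M.
have Mherm : M' \is hermsymmx.
  apply/is_hermitianmxP; rewrite expr0 scale1r; apply/matrixP => i j.
  by rewrite !mxE -[in LHS]Msym mxE; apply/esym/conjc_real.
have uP := spectral_unitarymx M'.
have /orthomx_spectralP ME := hermitian_normalmx Mherm.
pose e i := complex.Re (spectral_diag M' 0 i).
have eE : spectral_diag M' = \row_i f (e i).
  apply/rowP => i; rewrite mxE RRe_real //.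
  exact: (mxOverP (hermitian_spectral_diag_real Mherm)).
rewrite eE in ME; exists (spectralmx M'), e; split=> //.
  by rewrite -(invmx_unitary uP).
apply: (map_poly_inj f); rewrite map_char_poly -/M' ME.
rewrite char_poly_conj ?spectral_unit // char_poly_trig ?diag_mx_is_trig //.
rewrite rmorph_prod; apply: eq_bigr => i _.
by rewrite rmorphB /= map_polyX map_polyC !mxE eqxx mulr1n.
Qed.

Section Weights.
Variables (P : 'M[C]_m) (Z : 'M[R]_m).
Hypotheses (Punit : P \is unitarymx) (Zfeas : feasible Z).

Let W := P *m map_mx f Z *m P^t*.

Let Zsym : Z^T = Z.
Proof.
case: Zfeas => /is_hermitianmxP + _ _; rewrite expr0 scale1r => ZE.
by rewrite [RHS]ZE map_mx_id.
Qed.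

Let Zpsd : psdmx Z. Proof. by case: Zfeas. Qed.

Let W_form i : W i i = (((row i P)^t*)^t* *m map_mx f Z *m (row i P)^t*) 0 0.
Proof.
rewrite trmxCK /W [LHS]mxE [RHS]mxE; apply: eq_bigr => j _.
by rewrite -row_mul !mxE.
Qed.

Let W_herm i j : W j i = (W i j)^*.
Proof.
have /matrixP/(_ j i) -> : W = W^t*; last by rewrite 2!mxE.
rewrite /W !trmx_mul !map_mxM map_trmx trmxK -map_mx_comp (map_mx_id (@conjCK _)).
rewrite mulmxA; congr (_ *m _ *m _); apply/matrixP => k l; rewrite !mxE.
by rewrite -[in LHS]Zsym mxE; apply/esym/conjc_real.
Qed.

Lemma weight_ge0 i : 0 <= W i i.
Proof. by rewrite W_form complex_form // ler0c addr_ge0 //; exact: Zpsd. Qed.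

(** For y the conjugate transpose of row i of [P], W_ii = 0 says that y is isotropic, so Z y = 0;
    column i of [W] is P Z y, and row i is its conjugate. *)
Lemma weight_eq0 i : W i i = 0 -> forall j, W j i = 0 /\ W i j = 0.
Proof.
rewrite W_form => /(complex_psd_isotropic Zsym Zpsd) Z0 j.
have Wji : W j i = 0; last by rewrite (W_herm j) Wji rmorph0.
have : col i W = 0; last by move/colP/(_ j); rewrite !mxE.
by rewrite colE /W -!mulmxA -colE -map_col -tr_row Z0 mulmx0.
Qed.

Lemma weight_trace : \sum_i W i i = 1.
Proof.
rewrite -/(\tr W) /W mxtrace_mulC -invmx_unitary // mulmxA.
rewrite mulVmx ?unitarymx_unit // mul1mx trace_map_mx.
by case: Zfeas => _ _ ->; rewrite rmorph1.
Qed.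

Lemma inner_weights (M : 'M[R]_m) (d : 'rV[C]_m) : M^T = M ->
  map_mx f M = P^t* *m diag_mx d *m P ->
  f (mxinner M Z) = \sum_i d 0 i * W i i.
Proof.
move=> Msym ME; rewrite /mxinner Msym -trace_map_mx map_mxM ME.
rewrite -!mulmxA mxtrace_mulC -!mulmxA (mulmxA P) -/W.
by rewrite mul_diag_mx; apply: eq_bigr => i _; rewrite mxE.
Qed.

End Weights.

Section Maximum.
Variables (M : 'M[R]_m) (nu : R).
Hypotheses (Msym : M^T = M) (hnu : is_largest_eigenvalue M nu)
  (hmult : eigen_multiplicity M nu = 1%N).

(** [P] and [k] are chosen before [Z], so all maximisers share one image over [R[i]]. *)
Lemma spectral_maximizers : exists (P : 'M[C]_m) (k : 'I_m),
  [/\ P \is unitarymx, (forall Z, feasible Z -> mxinner M Z <= nu)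
    & forall Z, feasible Z -> mxinner M Z = nu ->
        map_mx f Z = P^t* *m delta_mx k k *m P].
Proof.
have [P [e [Pu ME charM]]] := real_sym_spectral Msym.
have e_le i : e i <= nu.
  apply: hnu.2; rewrite eigenvalue_root_char charM (bigD1 i) //=.
  by rewrite rootM root_XsubC eqxx.
have [k ek ne] : exists2 k, e k = nu & forall i, i != k -> e i != nu.
  by apply: simple_root_prod; rewrite -charM.
pose W Z := P *m map_mx f Z *m P^t*.
(* Since the weights sum to 1, nu is their average with constant value nu. *)
have gapE Z : feasible Z ->
    f (nu - mxinner M Z) = \sum_i f (nu - e i) * W Z i i.
  move=> hZ; rewrite rmorphB /= (inner_weights Z Msym ME).
  rewrite -[f nu]mulr1 -(weight_trace Pu hZ) mulr_sumr -sumrB.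
  by apply: eq_bigr => i _; rewrite [(\row__ _) 0 i]mxE rmorphB mulrBl.
have gap_ge0 Z i : feasible Z -> 0 <= f (nu - e i) * W Z i i.
  by move=> hZ; rewrite mulr_ge0 ?weight_ge0 // ler0c subr_ge0.
exists P, k; split=> // Z hZ.
  by rewrite -subr_ge0 -ler0c gapE // sumr_ge0 // => i _; exact: gap_ge0.
(* A zero gap kills every nonnegative summand, and nu - e i is nonzero for i other than k. *)
move=> Znu; have Wi0 i : i != k -> forall j, W Z j i = 0 /\ W Z i j = 0.
  move=> ik; apply: weight_eq0 => //.
  have /eqP := gapE Z hZ; rewrite Znu subrr rmorph0 eq_sym psumr_eq0; last first.
    by move=> l _; exact: gap_ge0.
  move=> /allP/(_ i); rewrite mem_index_enum => /(_ isT).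
  rewrite mulf_eq0 => /orP[|/eqP//].
  by rewrite fmorph_eq0 subr_eq0 eq_sym (negPf (ne _ ik)).
have WE : W Z = delta_mx k k.
  apply/matrixP => i j; rewrite [RHS]mxE.
  have [->|/Wi0/(_ j)[_ ->]//] := eqVneq i k.
  have [->|/Wi0/(_ k)[-> _]//] := eqVneq j k.
  (* W_kk is the only diagonal entry left, so it carries the whole trace. *)
  rewrite -(weight_trace Pu hZ) (bigD1 k) //= big1 ?addr0 // => l.
  by case/Wi0/(_ l).
rewrite -WE /W !mulmxA -invmx_unitary // mulVmx ?unitarymx_unit // mul1mx.
by rewrite -mulmxA mulVmx ?unitarymx_unit // mulmx1.
Qed.

End Maximum.
End Spectral.

(** * Optimality and uniqueness of the rank-one solution *)

Lemma norm2_outer_feasible (R : realType) m (mu : 'cV[R]_m) :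
  norm2 mu = 1 -> feasible (mu *m mu^T).
Proof.
move=> mu1; split.
- by apply/is_hermitianmxP; rewrite expr0 scale1r map_mx_id // trmx_mul trmxK.
- move=> x; rewrite mulmxA -mulmxA.
  (* This turns the form into the square of x^T mu. *)
  have -> : mu^T *m x = (x^T *m mu)^T by rewrite trmx_mul trmxK.
  by rewrite !mxE big_ord1 !mxE -expr2 sqr_ge0.
- rewrite mxtrace_mulC; move/(congr1 (fun t => t ^+ 2)): mu1.
  rewrite /norm2 sqr_sqrtr ?expr1n // /mxinner trace_mx11 mxE sumr_ge0 // => i _.
  by rewrite mxE -expr2 sqr_ge0.
Qed.

Lemma unique_optimal (R : realType) m (M : 'M[R]_m) (nu : R) (mu : 'cV[R]_m) :
  M^T = M -> is_largest_eigenvalue M nu -> eigen_multiplicity M nu = 1%N ->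
  M *m mu = nu *: mu -> norm2 mu = 1 ->
  unique (optimal_solution M) (mu *m mu^T).
Proof.
move=> Msym hnu hmult hmu mu1.
have [P [k [Pu le_nu eq_nu]]] := spectral_maximizers Msym hnu hmult.
have fmu := norm2_outer_feasible mu1.
have inner_mu : mxinner M (mu *m mu^T) = nu.
  rewrite /mxinner Msym mulmxA hmu -scalemxAl mxtraceZ.
  by case: fmu => _ _ ->; rewrite mulr1.
split=> [|Z [fZ optZ]]; first by split=> // Z fZ; rewrite inner_mu le_nu.
(* [mu *m mu^T] is a competitor of value nu, so the optimal [Z] cannot fall below it. *)
have Znu : mxinner M Z = nu.
  by apply/eqP; rewrite eq_le le_nu //= -{1}inner_mu optZ.
(* Both matrices map to the same P^* E_kk P, and the embedding is injective. *)
by apply: (@map_mx_inj _ _ (real_complex R)); rewrite !eq_nu.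
Qed.

Theorem corollary1 (R : realType) (n : nat) (D : 'M[R]_n.+1) (nu : R)
    (hnu : is_largest_eigenvalue (Adagger D) nu)
    (hmult : eigen_multiplicity (Adagger D) nu = 1%N)
    (mu : 'cV[R]_(2 ^ n))
    (hmu : Adagger D *m mu = nu *: mu)
    (hmu1 : norm2 mu = 1) :
  unique (optimal_solution (Adagger D)) (mu *m mu^T).
Proof. exact: unique_optimal (tr_Adagger D) hnu hmult hmu hmu1. Qed.
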